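(* Let $(V,g)$ be a Euclidean real vector space of dimension $n$ and let $R$ be a symmetric $(2,2)$ double form on $V$ satisfying the first Bianchi identity. For integers $m\ge1$ and $r\ge 0$ put $$h_{(r,2m)}(R)=\sum_{j=\max\{0,2m-r\}}^{2m}\frac{(-1)^{j}}{j!\,(r-2m+j)!}\,g^{r-2m+j}\,\mathrm c^{j}(R^m).$$ Let $i\ge 0$ be an integer. (1) If $n=2k$ is even, then $h_{(r,n-2i)}(R)=0$ for all integers $r$ with $2i+1\le r\le n-2i$. (2) If $n=2k+1$ is odd, then $h_{(r,n-2i-1)}(R)=0$ for all integers $r$ with $2i+2\le r\le n-2i-1$.
   Context: Let $(V,g)$ be a Euclidean real vector space of dimension $n$. A $(p,q)$ double form is an element of $\mathcal D^{p,q}=\Lambda^pV^*\otimes\Lambda^qV^*$, identified with a bilinear form $\Lambda^pV\times\Lambda^qV\to\mathbb R$. Exterior product: $(\theta_1\otimes\theta_2)(\theta_3\otimes\theta_4)=(\theta_1\wedge\theta_3)\otimes(\theta_2\wedge\theta_4)$, extended bilinearly; all products and powers in the claim are exterior products, with zeroth power $1$; $g$ is regarded as a $(1,1)$ double form. Contraction $\mathrm c:\mathcal D^{p,q}\to\mathcal D^{p-1,q-1}$: $\mathrm c\,\omega(x_1\wedge\dots\wedge x_{p-1},y_1\wedge\dots\wedge y_{q-1})=\sum_{j=1}^n\omega(e_j\wedge x_1\wedge\dots\wedge x_{p-1},e_j\wedge y_1\wedge\dots\wedge y_{q-1})$ for any orthonormal basis $(e_j)$ of $V$; $\mathrm c^j$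 is the $j$-fold iterate ($\mathrm c^0$ is the identity), and a $(0,0)$ double form is a scalar. A $(2,2)$ double form $R$ is symmetric if $R(u,v)=R(v,u)$ for $u,v\in\Lambda^2V$, and satisfies the first Bianchi identity if $\sum_{j=1}^{3}(-1)^jR(x_1\wedge\dots\widehat{x_j}\dots\wedge x_3,\;x_j\wedge y)=0$ for all $x_1,x_2,x_3,y\in V$. Background: for $r\le n-2m$ one has $h_{(r,2m)}(R)=\frac{1}{(n-2m-r)!}*(g^{n-2m-r}R^m)$ with $*$ the double Hodge star; the sum in the claim is the definition used when $r>n-2m$, which is the case in (1) and (2). *)

(* Defs.v *)
From HB Require Import structures.
From mathcomp Require Import all_boot all_order all_algebra.
From mathcomp Require Import reals.

Set Implicit Arguments.
Unset Strict Implicit.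
Unset Printing Implicit Defensive.

Import Order.TTheory GRing.Theory Num.Theory.
Local Open Scope ring_scope.

Section DoubleForms.
Variables (R : realType) (V : vectType R).

(* An element of Lambda^p V^* is an alternating p-linear form on V, represented
   by a function of the list of its arguments which is extended by 0 to the
   lists whose length is not p. With this convention the direct sum of the
   Lambda^p V^* (and below of the D^{p,q}) lives in a single type, and products
   and powers need no cast between degrees. *)
Definition alternating_form (p : nat) (f : seq V -> R) : Prop :=
  [/\ forall s x y t a,
        f (s ++ (a *: x + y) :: t) = a * f (s ++ x :: t) + f (s ++ y :: t),
      forall s x t u, f (s ++ x :: t ++ x :: u) = 0
    & forall s, size s != p -> f s = 0].

(* [w [:: x1; ..; xp] [:: y1; ..; yq]] is w(x1 /\ .. /\ xp, y1 /\ .. /\ yq). *)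
Definition dform := seq V -> seq V -> R.

Definition double_form (p q : nat) (w : dform) : Prop :=
  (forall ys, alternating_form p (w^~ ys)) /\
  (forall xs, alternating_form q (w xs)).

(* The sign of the shuffle that lists first, in increasing order, the positions
   selected by m, and then the other ones. *)
Definition shuffle_sign (m : bitseq) : R :=
  (-1) ^+ #|[set ij : 'I_(size m) * 'I_(size m) |
             [&& (ij.1 < ij.2)%N, ~~ nth false m ij.1 & nth false m ij.2]]|.

(* (f /\ h)(x_1, .., x_N) = \sum_s sgn(s) f(x_s(1), .., x_s(p)) h(x_s(p+1), ..)
   over the (p, N - p)-shuffles s; only the masks selecting p positions
   contribute when f has degree p. *)
Definition wedge (f h : seq V -> R) : seq V -> R := fun s =>
  \sum_(m : (size s).-tuple bool)
    shuffle_sign m * (f (mask m s) * h (mask (map negb m) s)).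

Definition tens (f h : seq V -> R) : dform := fun xs ys => f xs * h ys.

(* The bilinear extension of
   (f1 (x) f2) (f3 (x) f4) = (f1 /\ f3) (x) (f2 /\ f4), see [dmul_tens]. *)
Definition dmul (w1 w2 : dform) : dform := fun xs ys =>
  \sum_(m : (size xs).-tuple bool) \sum_(l : (size ys).-tuple bool)
    shuffle_sign m * shuffle_sign l *
    (w1 (mask m xs) (mask l ys) *
     w2 (mask (map negb m) xs) (mask (map negb l) ys)).

Definition dform1 : dform := fun xs ys => (nilp xs && nilp ys)%:R.

Definition dexp (w : dform) (k : nat) : dform := iter k (dmul w) dform1.

Definition metric_form (g : V -> V -> R) : dform := fun xs ys =>
  if (xs, ys) is ([:: x], [:: y]) then g x y else 0.

Definition orthonormal_basis (g : {dot V for idfun}) (e : seq V) : bool :=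
  orthonormal g e && basis_of fullv e.

(* To be used with an orthonormal basis e, the choice of which is irrelevant
   by [contr_indep]. *)
Definition contr (e : seq V) (w : dform) : dform := fun xs ys =>
  \sum_(v <- e) w (v :: xs) (v :: ys).

Definition dsymmetric (w : dform) : Prop := forall xs ys, w xs ys = w ys xs.

Definition first_bianchi (w : dform) : Prop := forall x1 x2 x3 y,
  - w [:: x2; x3] [:: x1; y] + w [:: x1; x3] [:: x2; y]
  - w [:: x1; x2] [:: x3; y] = 0.

(* h_(r,2m). The natural number subtraction 2 * m - r is max{0, 2m - r}, and
   r + j - 2 * m is exact in the range of the sum. *)
Definition h_form (g : {dot V for idfun}) (e : seq V) (w : dform)
    (r m : nat) : dform := fun xs ys =>
  \sum_((2 * m - r)%N <= j < (2 * m).+1)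
    (-1) ^+ j / (j`! * (r + j - 2 * m)`!)%N%:R *
    dmul (dexp (metric_form g) (r + j - 2 * m)%N)
         (iter j (contr e) (dexp w m)) xs ys.

Lemma dmul_tens f1 f2 f3 f4 xs ys :
  dmul (tens f1 f2) (tens f3 f4) xs ys =
  tens (wedge f1 f3) (wedge f2 f4) xs ys.
Proof.
rewrite /dmul /tens /wedge mulr_suml; apply: eq_bigr => m _.
rewrite mulr_sumr; apply: eq_bigr => l _.
by rewrite [RHS]mulrACA; congr (_ * _); rewrite mulrACA.
Qed.

Lemma pair_orthoP (g : {dot V for idfun}) v (e : seq V) :
  orthonormal g (v :: e) =
  [&& g v v == 1, all (fun u => g v u == 0) e & orthonormal g e].
Proof.
rewrite /orthonormal /= /ortho_rec /= andbT -!andbA; congr (_ && _).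
by rewrite andbCA.
Qed.

Lemma dotC (g : {dot V for idfun}) x y : g x y = g y x.
Proof. by rewrite (hermC (theta := idfun)) expr0 mul1r. Qed.

Lemma dot_gt0 (g : {dot V for idfun}) x : x != 0 -> 0 < g x x.
Proof. exact: neq0_dnorm_gt0. Qed.

Lemma orthonormal_proj0 (g : {dot V for idfun}) e x u :
  orthonormal g e -> u \in e -> g (x - \sum_(v <- e) g x v *: v) u = 0.
Proof.
move=> + ue; suff H : orthonormal g e -> \sum_(v <- e) g x v * g v u = g x u.
  move=> /H {}H; rewrite linearBl linear_sumlz.
  by under eq_bigr do rewrite linearZl_LR /=; rewrite H subrr.
elim: e ue => // v e IH; rewrite inE pair_orthoP big_cons.
case/orP=> [/eqP <-|ue] /and3P[/eqP u1 /allP oe one].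
  rewrite u1 mulr1 big_seq big1 ?addr0 // => w we.
  by rewrite (dotC g w) (eqP (oe _ we)) mulr0.
by rewrite (eqP (oe _ ue)) mulr0 add0r IH.
Qed.

Lemma orthonormal_expand (g : {dot V for idfun}) e x :
  orthonormal g e -> x \in <<e>>%VS -> x = \sum_(v <- e) g x v *: v.
Proof.
move=> oe xe; apply/eqP; rewrite -subr_eq0; apply/negPn/negP => y0.
set y := x - _ in y0; have ye : y \in <<e>>%VS.
  rewrite rpredB // big_seq rpred_sum // => v ve.
  by rewrite rpredZ // memv_span.
have := dot_gt0 g y0.
rewrite [X in g _ X](coord_span (X := in_tuple e)) // linear_sumr.
rewrite big1 ?ltxx // => i _; rewrite linearZr_LR /=.
by rewrite orthonormal_proj0 ?mulr0 // mem_nth.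
Qed.

Lemma orthonormal_free (g : {dot V for idfun}) e : orthonormal g e -> free e.
Proof.
elim: e => [|v e IH]; first by rewrite nil_free.
rewrite pair_orthoP free_cons => /and3P[/eqP v1 /allP ve oe].
rewrite (IH oe) andbT; apply/negP => /(orthonormal_expand oe) vE.
suff v0 : v = 0 by move: v1; rewrite v0 linear0l => /eqP; rewrite eq_sym oner_eq0.
by rewrite vE big_seq big1 // => u /ve/eqP ->; rewrite scale0r.
Qed.

Lemma orthonormal_basis_exists (g : {dot V for idfun}) :
  exists e, orthonormal_basis g e.
Proof.
have [e oe se] : exists2 e, orthonormal g e & <<e>>%VS = <<vbasis {:V}>>%VS.
  elim: (tval (vbasis {:V})) => [|x s [e oe se]]; first by exists [::].
  set y := x - \sum_(v <- e) g x v *: v.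
  have pe : \sum_(v <- e) g x v *: v \in <<e>>%VS.
    by rewrite big_seq rpred_sum // => v ve; rewrite rpredZ // memv_span.
  have xE : x = y + \sum_(v <- e) g x v *: v by rewrite subrK.
  have [y0|y0] := eqVneq y 0.
    exists e => //; rewrite span_cons -se; apply/esym/addv_idPr.
    by rewrite -memvE xE y0 add0r.
  have gy := dot_gt0 g y0.
  set a := (Num.sqrt (g y y))^-1.
  have a0 : a != 0 by rewrite invr_eq0 gt_eqF // sqrtr_gt0.
  exists (a *: y :: e).
    rewrite pair_orthoP oe andbT; apply/andP; split.
      rewrite linearZl_LR linearZr_LR /= mulrA -expr2 exprVn sqr_sqrtr ?ltW //.
      by rewrite mulVf // gt_eqF.
    apply/allP => u ue; rewrite linearZl_LR /=.
    by rewrite orthonormal_proj0 // mulr0.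
  have ya : y = a^-1 *: (a *: y) by rewrite scalerA mulVf // scale1r.
  rewrite !span_cons -se; apply/eqP; rewrite eqEsubv !subv_add !addvSr !andbT.
  rewrite -!memvE; apply/andP; split.
    rewrite rpredZ // /y rpredB //.
      by apply: (subvP (addvSl _ _)); exact: memv_line.
    by apply: subvP pe; exact: addvSr.
  rewrite xE rpredD //; last by apply: subvP pe; exact: addvSr.
  rewrite {1}ya rpredZ //; apply: (subvP (addvSl _ _)); exact: memv_line.
exists e; rewrite /orthonormal_basis oe /basis_of se (orthonormal_free oe).
by rewrite (span_basis (vbasisP _)) eqxx.
Qed.

Lemma alternating_form_suml p f (r : seq V) (a : V -> R) t :
  alternating_form p f ->
  f ((\sum_(v <- r) a v *: v) :: t) = \sum_(v <- r) a v * f (v :: t).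
Proof.
case=> lin _ _; have f0 : f (0 :: t) = 0.
  have := lin [::] 0 0 t 1; rewrite scaler0 addr0 mul1r /=.
  by move/eqP; rewrite -subr_eq0 opprD addrA subrr sub0r oppr_eq0 => /eqP.
elim: r => [|v r IH]; first by rewrite !big_nil.
by rewrite !big_cons -IH; exact: (lin [::]).
Qed.

Lemma dot_sum_orthonormal (g : {dot V for idfun}) e u (B : V -> R) :
  orthonormal g e -> u \in e -> \sum_(v <- e) g u v * B v = B u.
Proof.
elim: e => // v e IH; rewrite inE pair_orthoP big_cons.
move=> /and3P[/eqP v1 /allP oe one] /orP[/eqP ->|ue].
  rewrite v1 mul1r big_seq big1 ?addr0 // => w we.
  by rewrite (eqP (oe _ we)) mul0r.
by rewrite (dotC g u) (eqP (oe _ ue)) mul0r add0r IH.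
Qed.

Lemma contr_indep (g : {dot V for idfun}) e e' p q w xs ys :
  orthonormal_basis g e -> orthonormal_basis g e' -> double_form p q w ->
  contr e w xs ys = contr e' w xs ys.
Proof.
move=> /andP[oe be] /andP[oe' be'] [wl wr]; rewrite /contr.
pose B u v := w (u :: xs) (v :: ys).
have expand d x : orthonormal g d -> basis_of fullv d ->
    x = \sum_(v <- d) g x v *: v.
  by move=> od bd; apply: orthonormal_expand => //; rewrite (span_basis bd) memvf.
have Bl x y : B x y = \sum_(u <- e') g x u * B u y.
  by rewrite /B [in LHS](expand e' x) // (alternating_form_suml _ _ _ (wl _)).
have Br x y : B x y = \sum_(u <- e') g y u * B x u.
  by rewrite /B [in LHS](expand e' y) // (alternating_form_suml _ _ _ (wr _)).
have BE v : B v v =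
    \sum_(u <- e') \sum_(u' <- e') g v u * g v u' * B u u'.
  rewrite Bl; apply: eq_bigr => u _; rewrite Br mulr_sumr.
  by apply: eq_bigr => u' _; rewrite mulrA.
rewrite (eq_bigr _ (fun v _ => BE v)) exchange_big /=.
rewrite big_seq [RHS]big_seq; apply: eq_bigr => u ue'.
rewrite exchange_big /= -/(B u u) -(dot_sum_orthonormal (B u) oe' ue').
apply: eq_bigr => u' _; rewrite -mulr_suml; congr (_ * _).
rewrite [in RHS](expand e u oe be) linear_sumlz.
by apply: eq_bigr => v _; rewrite linearZl_LR /= (dotC g v u).
Qed.

Lemma contr_double_form e p q w :
  double_form p.+1 q.+1 w -> double_form p q (contr e w).
Proof.
case=> wl wr; split=> [ys|xs]; split.
- move=> s x y t a; rewrite /contr mulr_sumr -big_split; apply: eq_bigr => v _.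
  by have [lin _ _] := wl (v :: ys); exact: (lin (v :: s)).
- move=> s x t u; rewrite /contr big1 // => v _.
  by have [_ alt _] := wl (v :: ys); exact: (alt (v :: s)).
- move=> s sp; rewrite /contr big1 // => v _.
  by have [_ _ deg] := wl (v :: ys); apply: deg.
- move=> s x y t a; rewrite /contr mulr_sumr -big_split; apply: eq_bigr => v _.
  by have [lin _ _] := wr (v :: xs); exact: (lin (v :: s)).
- move=> s x t u; rewrite /contr big1 // => v _.
  by have [_ alt _] := wr (v :: xs); exact: (alt (v :: s)).
- move=> s sp; rewrite /contr big1 // => v _.
  by have [_ _ deg] := wr (v :: xs); apply: deg.
Qed.

End DoubleForms.

Arguments dform {R} V.

(* Main.v *)
(* h_(r,2m) is the part of bidegree (r, r) of exp(g) exp(-c) applied to R^m.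
   For an orthonormal basis (e_v), let g_v be the exterior product by g(e_v,
   _) in both slots and c_v the contraction by e_v in both slots. The g_v
   commute and square to zero, so do the c_v, and c_u commutes with g_v for
   u <> v; hence exp(g) exp(-c) is the product of the (1 + g_v)(1 - c_v).
   Evaluated on basis vectors, such a factor removes e_v from both slots if
   it occurs in both, does nothing if it occurs in exactly one of them, and
   otherwise either leaves the arguments alone or adds e_v to both. If it
   starts from r vectors in each slot, the first slot thus ends up with at
   most n - r vectors, so the value is 0 on forms of bidegree (p, p) with p
   > n - r. *)
Require Import Defs.
From mathcomp Require Import all_boot all_order all_algebra.
From mathcomp Require Import reals boolp functions.
From mathcomp Require Import zify ring lra.

Set Implicit Arguments.
Unset Strict Implicit.
Unset Printing Implicit Defensive.

Import GRing.Theory Num.Theory.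
Local Open Scope ring_scope.

(** * Exterior product by a covector, and shuffle sums, for functions of lists *)

Section ListForms.
Variables (R : realType) (V : vectType R).
Implicit Types (l : V -> R) (f h : seq V -> R) (s t : seq V).

Definition mlin f := forall s x y t a,
  f (s ++ (a *: x + y) :: t) = a * f (s ++ x :: t) + f (s ++ y :: t).

(** Adjacent repetitions suit inductions on the list; [adjalt_nuniq] recovers all repetitions from
    multilinearity. *)
Definition adjalt f := forall s x t, f (s ++ x :: x :: t) = 0.

(* [eps l f] is l /\ f, expanded along the first argument. *)
Fixpoint eps l f s : R :=
  if s is x :: s' then l x * f s' - eps l (fun u => f (x :: u)) s' else 0.

Lemma eps_lin l a f h s :
  eps l (fun u => a * f u + h u) s = a * eps l f s + eps l h s.
Proof.
elim: s f h => [|x s IH] f h /=; first by rewrite mulr0 addr0.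
by rewrite IH; ring.
Qed.

Lemma epsB l f h s : eps l (fun u => f u - h u) s = eps l f s - eps l h s.
Proof.
elim: s f h => [|x s IH] f h /=; first by rewrite subr0.
by rewrite IH; ring.
Qed.

Lemma epsZ l a f s : eps l (fun u => a * f u) s = a * eps l f s.
Proof.
elim: s f => [|x s IH] f /=; first by rewrite mulr0.
by rewrite IH; ring.
Qed.

Lemma eps_zero l f s :
  (forall u, (size u).+1 = size s -> f u = 0) -> eps l f s = 0.
Proof.
elim: s f => //= x s IH f f0.
rewrite f0 // mulr0 IH ?subrr // => u us; apply: f0 => /=.
by rewrite us.
Qed.

Lemma eps_perp l f s : {in s, forall x, l x = 0} -> eps l f s = 0.
Proof.
elim: s f => //= x s IH f lx.
rewrite lx ?mem_head // mul0r IH ?subrr // => y ys.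
by rewrite lx // inE ys orbT.
Qed.

(** A head argument [x] contributes [l x * eps l' f s - l' x * eps l f s], which is antisymmetric in
    [l] and [l']. *)
Lemma eps_anti l l' f s : eps l (eps l' f) s = - eps l' (eps l f) s.
Proof.
elim: s f => [|x s IH] f /=; first by rewrite oppr0.
by rewrite !epsB !epsZ IH; ring.
Qed.

Lemma eps_sq l f s : eps l (eps l f) s = 0.
Proof. by have := eps_anti l l f s; lra. Qed.

Lemma eps_exch l l' (F : dform V) s t :
  eps l (fun u => eps l' (F u) t) s = eps l' (fun w => eps l (F^~ w) s) t.
Proof.
elim: s F => [|x s IH] F /=; first by rewrite eps_zero.
by rewrite (IH (fun u => F (x :: u))) epsB epsZ.
Qed.

Lemma mlin_cons f x : mlin f -> mlin (fun u => f (x :: u)).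
Proof. by move=> fl s; exact: (fl (x :: s)). Qed.

Lemma adjalt_cons f x : adjalt f -> adjalt (fun u => f (x :: u)).
Proof. by move=> fl s; exact: (fl (x :: s)). Qed.

Lemma eps_mlin l f : scalar l -> mlin f -> mlin (eps l f).
Proof.
move=> ll + s; elim: s f => [|z s IH] f fl x y t a /=.
  rewrite ll (_ : (fun u => f (_ :: u)) = fun u => a * f (x :: u) + f (y :: u)).
    by rewrite eps_lin /=; ring.
  by apply/funext => u; exact: (fl [::]).
by rewrite (IH _ (mlin_cons z fl)) fl; ring.
Qed.

Lemma eps_adjalt l f : adjalt f -> adjalt (eps l f).
Proof.
move=> + s; elim: s f => [|z s IH] f fa x t /=.
  rewrite [X in _ - (_ - X)]eps_zero; first by ring.
  by move=> u _; exact: (fa [::]).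
by rewrite (IH _ (adjalt_cons z fa)) fa; ring.
Qed.

Lemma adjalt_swap f x y s :
  mlin f -> adjalt f -> f (x :: y :: s) = - f (y :: x :: s).
Proof.
(* Polarization: [f] vanishes when its first two arguments are both [x + y]. The coefficient [1]
   fits the shape of [mlin]. *)
move=> fl fa; have := fa [::] (1 *: x + y) s.
have /= -> := fl [::] x y ((1 *: x + y) :: s) 1.
have /= -> := fl [:: x] x y s 1; have /= -> := fl [:: y] x y s 1.
have /= -> := fa [::] x s; have /= -> := fa [::] y s.
by move=> E; apply/eqP; rewrite -addr_eq0; apply/eqP; rewrite -[RHS]E; ring.
Qed.

Lemma adjalt_front f s x t : mlin f -> adjalt f ->
  f (s ++ x :: t) = (-1) ^+ size s * f (x :: s ++ t).
Proof.
elim: s f => [|z s IH] f fl fa /=; first by rewrite mul1r.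
rewrite (IH _ (mlin_cons z fl) (adjalt_cons z fa)) adjalt_swap // exprS; ring.
Qed.

Lemma adjalt_nuniq f s : mlin f -> adjalt f -> ~~ uniq s -> f s = 0.
Proof.
elim: s f => //= x s IH f fl fa; have [xs _|_ /=] := boolP (x \in s).
  case/splitPr: xs => s1 s2.
  rewrite (adjalt_front (f := fun u => f (x :: u))) ?(fa [::]) ?mulr0 //.
    exact: mlin_cons.
  exact: adjalt_cons.
exact: IH (mlin_cons x fl) (adjalt_cons x fa).
Qed.

(* The sum of [wedge] with an arbitrary [F u v] in place of [f u * h v]; the two
   slots of [dmul] can then be treated one after the other, see [dmulE]. *)
Definition unshuffle (F : dform V) s : R :=
  \sum_(m : (size s).-tuple bool)
    shuffle_sign R m * F (mask m s) (mask (map negb m) s).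

Lemma shuffle_signE (m : bitseq) :
  shuffle_sign R m = (-1) ^+ (\sum_(i < size m) \sum_(j < size m)
    [&& i < j, ~~ nth false m i & nth false m j])%N.
Proof.
rewrite /shuffle_sign pair_big /= -sum1_card big_mkcond /=.
by congr (_ ^+ _); apply: eq_bigr => -[i j] _; rewrite inE; case: ifP.
Qed.

(** An inversion is an unselected position before a selected one: a selected head creates none, an
    unselected head one for each selected position of [m]. *)
Lemma shuffle_sign_cons b (m : bitseq) :
  shuffle_sign R (b :: m) =
  (if b then 1 else (-1) ^+ count id m) * shuffle_sign R m.
Proof.
rewrite !shuffle_signE /= big_ord_recl big_ord_recl /= add0n.
under [X in (_ + X)%N]eq_bigr => i _ do rewrite big_ord_recl /= add0n.
rewrite exprD; congr (_ * _).
case: b => /=; first by rewrite big1 ?expr0.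
by congr (_ ^+ _); rewrite -sumn_count sumnE big_map (big_nth false) big_mkord.
Qed.

Lemma unshuffle_nil F : unshuffle F [::] = F [::] [::].
Proof.
rewrite /unshuffle (big_pred1 [tuple]) => [|m]; last exact/esym/eqP/tuple0.
by rewrite /= /shuffle_sign eq_card0 ?expr0 ?mul1r // => -[[]].
Qed.

(** The head goes to the left block, or to the right block past the whole left block. This recursion
    replaces masks in the inductions below. *)
Lemma unshuffle_cons F x s :
  unshuffle F (x :: s) = unshuffle (fun a => F (x :: a)) s +
    unshuffle (fun a b => (-1) ^+ size a * F a (x :: b)) s.
Proof.
rewrite /unshuffle (reindex (fun p : bool * (size s).-tuple bool =>
  cons_tuple p.1 p.2)) /=; last first.
  exists (fun m => (thead m, [tuple of behead m])) => [[b m] _|m _] /=.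
    by congr pair; apply: val_inj.
  by rewrite [RHS]tuple_eta; apply: val_inj.
rewrite -(pair_bigA _ (fun b (m : (size s).-tuple bool) =>
  shuffle_sign R (b :: m) * F (mask (b :: m) (x :: s))
    (mask (map negb (b :: m)) (x :: s)))) /=.
rewrite big_bool /=; congr (_ + _); apply: eq_bigr => m _.
  by rewrite shuffle_sign_cons mul1r.
rewrite shuffle_sign_cons size_mask ?size_tuple //; ring.
Qed.

Lemma unshuffle_lin a F H s :
  unshuffle (fun u v => a * F u v + H u v) s =
  a * unshuffle F s + unshuffle H s.
Proof.
rewrite /unshuffle mulr_sumr -big_split; apply: eq_bigr => m _ /=; ring.
Qed.

Lemma unshuffle0 s : unshuffle (fun _ _ => 0) s = 0.
Proof. by rewrite /unshuffle big1 // => m _; rewrite mulr0. Qed.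


Lemma unshuffleZ a F s :
  unshuffle (fun u v => a * F u v) s = a * unshuffle F s.
Proof. by rewrite /unshuffle mulr_sumr; apply: eq_bigr => m _; ring. Qed.

Lemma unshuffleB F H s :
  unshuffle (fun u v => F u v - H u v) s = unshuffle F s - unshuffle H s.
Proof.
rewrite /unshuffle -sumrB; apply: eq_bigr => m _; ring.
Qed.

Lemma unshuffle_sum (I : Type) (r : seq I) (F : I -> dform V) s :
  unshuffle (fun u v => \sum_(i <- r) F i u v) s =
  \sum_(i <- r) unshuffle (F i) s.
Proof.
rewrite /unshuffle exchange_big /=; apply: eq_bigr => m _.
by rewrite -mulr_sumr.
Qed.

Lemma unshuffle_eps l (F : seq V -> dform V) s t :
  unshuffle (fun u v => eps l (fun a => F a u v) t) s =
  eps l (fun a => unshuffle (F a) s) t.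
Proof.
elim: t F => [|x t IH] F /=; first exact: unshuffle0.
by rewrite unshuffleB unshuffleZ (IH (fun a => F (x :: a))).
Qed.

Lemma eps_sign l f s :
  eps l (fun u => (-1) ^+ size u * f u) s = - (-1) ^+ size s * eps l f s.
Proof.
elim: s f => [|x s IH] f /=; first by rewrite mulr0.
rewrite (_ : (fun u => _) = fun u => -1 * ((-1) ^+ size u * f (x :: u))).
  by rewrite epsZ IH exprS; ring.
by apply/funext => u; rewrite exprS mulrA.
Qed.

(** Associativity [l /\ (f /\ h) = (l /\ f) /\ h], by expanding both sides along the head
    argument. *)
Lemma eps_unshuffle l F s :
  unshuffle (fun a b => eps l (F^~ b) a) s = eps l (unshuffle F) s.
Proof.
elim: s F => [|x s IH] F; first by rewrite unshuffle_nil.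
rewrite unshuffle_cons /= unshuffleB unshuffleZ (IH (fun a => F (x :: a))).
have -> : (fun u => unshuffle F (x :: u)) = fun u =>
    1 * unshuffle (fun a => F (x :: a)) u +
    unshuffle (fun a b => (-1) ^+ size a * F a (x :: b)) u.
  by apply/funext => u; rewrite mul1r unshuffle_cons.
rewrite eps_lin -(IH (fun a b => (-1) ^+ size a * F a (x :: b))).
have -> : (fun a b => eps l (fun u => (-1) ^+ size u * F u (x :: b)) a) =
    fun a b => -1 * ((-1) ^+ size a * eps l (F^~ (x :: b)) a).
  by apply/funext => a; apply/funext => b; rewrite eps_sign; ring.
by rewrite unshuffleZ; ring.
Qed.

Lemma mlin_sign f : mlin f -> mlin (fun u => (-1) ^+ size u * f u).
Proof. by move=> fl s x y t a; rewrite fl !size_cat /=; ring. Qed.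

Lemma adjalt_sign f : adjalt f -> adjalt (fun u => (-1) ^+ size u * f u).
Proof. by move=> fa s x t; rewrite fa mulr0. Qed.

Lemma unshuffle_mlin F : (forall u, mlin (F u)) -> (forall u, mlin (F^~ u)) ->
  mlin (unshuffle F).
Proof.
move=> + + s; elim: s F => [|z s IH] F Fr Fl x y t a; last first.
  rewrite !unshuffle_cons /= (IH (fun b => F (z :: b))) //; first last.
    by move=> u; exact: (mlin_cons z (Fl u)).
  rewrite IH //; first by ring.
    by move=> u s' x' y' t' a'; rewrite (Fr u (z :: s')); ring.
  by move=> u; apply: mlin_sign.
rewrite !unshuffle_cons /=.
have -> : (fun b => F (a *: x + y :: b)) =
    fun b c => a * F (x :: b) c + F (y :: b) c.
  by apply/funext => b; apply/funext => c; exact: (Fl c [::]).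
rewrite unshuffle_lin.
have -> : (fun b c => (-1) ^+ size b * F b (a *: x + y :: c)) = fun b c =>
    a * ((-1) ^+ size b * F b (x :: c)) + (-1) ^+ size b * F b (y :: c).
  by apply/funext => b; apply/funext => c; rewrite (Fr b [::]) /=; ring.
by rewrite unshuffle_lin; ring.
Qed.

(** On [x :: x :: t], the shuffles sending both copies to one block vanish since [F] alternates
    there; the two ways of separating the copies have opposite signs and cancel. *)
Lemma unshuffle_adjalt F :
  (forall u, adjalt (F u)) -> (forall u, adjalt (F^~ u)) ->
  adjalt (unshuffle F).
Proof.
move=> + + s; elim: s F => [|z s IH] F Fr Fl x t; last first.
  rewrite !unshuffle_cons /= (IH (fun b => F (z :: b))) //; last first.
    by move=> u; exact: (adjalt_cons z (Fl u)).
  rewrite IH ?addr0 //.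
    by move=> u s' x' t'; rewrite (Fr u (z :: s')) mulr0.
  by move=> u; apply: adjalt_sign.
rewrite !unshuffle_cons /=.
have -> : (fun b => F (x :: x :: b)) = fun _ _ => 0.
  by apply/funext => b; apply/funext => c; exact: (Fl c [::]).
have -> : (fun b c => (-1) ^+ size b * ((-1) ^+ size b * F b (x :: x :: c))) =
    fun _ _ => 0.
  by apply/funext => b; apply/funext => c; rewrite (Fr b [::]) !mulr0.
rewrite !unshuffle0 add0r addr0.
rewrite (_ : (fun b c => (-1) ^+ (size b).+1 * F _ _) =
  fun b c => -1 * ((-1) ^+ size b * F (x :: b) (x :: c))).
  by rewrite unshuffleZ; ring.
by apply/funext => b; apply/funext => c; rewrite exprS; ring.
Qed.

Lemma unshuffle_zero F s :
  (forall u v, (size u + size v)%N = size s -> F u v = 0) -> unshuffle F s = 0.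
Proof.
move=> F0; rewrite /unshuffle big1 // => m _.
rewrite F0 ?mulr0 // !size_mask ?size_map ?size_tuple //.
by rewrite count_map -[RHS](size_tuple m); exact: count_predC.
Qed.

Definition nilf s : R := (nilp s)%:R.
Lemma unshuffle_nilf f s : unshuffle (fun a b => nilf a * f b) s = f s.
Proof.
elim: s f => [|x s IH] f; first by rewrite unshuffle_nil mul1r.
rewrite unshuffle_cons /= (_ : (fun a b => _) = fun _ _ => 0).
  rewrite unshuffle0 add0r.
  rewrite (_ : (fun a b => _) = fun a b => nilf a * f (x :: b)).
    by rewrite (IH (fun b => f (x :: b))).
  by apply/funext => -[|y a]; apply/funext => b; rewrite /nilf /=; ring.
by apply/funext => a; apply/funext => b; rewrite mul0r.
Qed.

End ListForms.

(** * Elementary symmetric functions of commuting square-zero operators *)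

Section SquareZero.
(** [P] marks where the operators commute and square to zero; contractions do so on alternating
    multilinear forms. *)
Variables (I : Type) (M : zmodType) (t : I -> M -> M) (P : M -> Prop).
Hypothesis tD : forall v, {morph t v : x y / x + y}.
Hypothesis P0 : P 0.
Hypothesis PD : forall x y, P x -> P y -> P (x + y).
Hypothesis Pt : forall v x, P x -> P (t v x).
Hypothesis t_sq : forall v x, P x -> t v (t v x) = 0.
Hypothesis tC : forall u v x, P x -> t u (t v x) = t v (t u x).

(* Under the hypotheses above, [divpow e k] is (\sum_v t v)^k / k!, that is the
   k-th elementary symmetric function of the [t v], and [prod1t e] is the
   product of the 1 + t v. *)
Fixpoint divpow (e : seq I) k (x : M) : M :=
  match e, k with
  | _, 0 => x
  | [::], _.+1 => 0
  | v :: e', k'.+1 => divpow e' k'.+1 x + t v (divpow e' k' x)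
  end.

Fixpoint prod1t (e : seq I) (x : M) : M :=
  if e is v :: e' then prod1t e' x + t v (prod1t e' x) else x.

Let t0 v : t v 0 = 0.
Proof. by apply: (addIr (t v 0)); rewrite -tD !add0r. Qed.

Let t_sum v N (F : 'I_N -> M) : t v (\sum_k F k) = \sum_k t v (F k).
Proof. exact: (big_morph _ (tD v) (t0 v)). Qed.

Let tMn v x k : t v (x *+ k) = t v x *+ k.
Proof. by elim: k => [|k IH]; rewrite ?mulr0n // !mulrS tD IH. Qed.

Lemma divpow0 e x : divpow e 0 x = x.
Proof. by case: e. Qed.

Lemma divpow_closed e k x : P x -> P (divpow e k x).
Proof.
move=> Px; elim: e k => [|v e IH] [|k] //=.
by apply: PD => //; apply: Pt.
Qed.

Lemma prod1t_closed e x : P x -> P (prod1t e x).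
Proof. by move=> Px; elim: e => //= v e IH; apply: PD => //; apply: Pt. Qed.

(** A product of [k.+1] distinct [t v] arises once for each choice of the factor applied last, and a
    repeated factor gives zero. *)
Lemma sum_divpow e k x : P x ->
  \sum_(v <- e) t v (divpow e k x) = divpow e k.+1 x *+ k.+1.
Proof.
move=> Px; elim: e k => [|v e IH] k; first by rewrite big_nil mul0rn.
have TC y : P y -> \sum_(u <- e) t u (t v y) = t v (\sum_(u <- e) t u y).
  move=> Py; rewrite (big_morph _ (tD v) (t0 v)).
  by apply: eq_bigr => u _; rewrite tC.
case: k => [|k]; rewrite big_cons /=.
  rewrite divpow0 mulr1n addrC; congr (_ + _).
  by have := IH 0%N; rewrite divpow0.
under eq_bigr do rewrite tD.
rewrite big_split /= IH TC; last exact: divpow_closed.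
(* The head [v] adds one copy of [t v (divpow e k.+1 x)] to the [k.+1] copies coming from the
   tail. *)
rewrite IH tD t_sq ?addr0; last exact: divpow_closed.
by rewrite tMn addrCA -mulrS mulrnDl.
Qed.

Lemma iter_divpow e k x : P x ->
  iter k (fun y => \sum_(v <- e) t v y) x = divpow e k x *+ k`!.
Proof.
move=> Px; elim: k => [|k IH]; first by rewrite divpow0.
rewrite iterS IH; under eq_bigr do rewrite tMn.
by rewrite sumrMnl sum_divpow // factS mulrnA.
Qed.

(** Expanding the product gives all elementary symmetric functions; those of index above [size e]
    vanish, so any larger bound serves. *)
Lemma sum_prod1t e x N : (size e < N)%N ->
  \sum_(k < N) divpow e k x = prod1t e x.
Proof.
elim: e N => [|v e IH] [|N] //= eN.
  by rewrite big_ord_recl big1 ?addr0.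
(* The terms with [t v] are one index behind the others: the induction hypothesis serves at [N] for
   them and at [N.+1] for the rest. *)
rewrite big_ord_recl big_split /= -t_sum (IH N) // addrA; congr (_ + _).
by rewrite -(IH N.+1) 1?ltnW // big_ord_recl divpow0.
Qed.

End SquareZero.

(** * Multiplication and contraction operators on double forms *)

Section DoubleFormOperators.
Variables (R : realType) (V : vectType R).
Implicit Types (l : V -> R) (w : dform V) (v x : V) (xs ys : seq V).

(** Unlike in [double_form], no bidegree is fixed, so that inhomogeneous sums such as [w - cop v w]
    qualify. *)
Definition multialt w :=
  [/\ forall u, mlin (w u), forall u, mlin (w^~ u),
      forall u, adjalt (w u) & forall u, adjalt (w^~ u)].

(** The product by [l] tensor [l]; for a basis vector [v], [gop (g v)] and [cop v] are the operators
    g_v and c_v of the overview. *)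
Definition gop l w : dform V := fun xs ys => eps l (fun a => eps l (w a) ys) xs.

Definition cop v w : dform V := fun xs ys => w (v :: xs) (v :: ys).

Lemma gop_exch l w xs ys :
  gop l w xs ys = eps l (fun b => eps l (w^~ b) xs) ys.
Proof. exact: eps_exch. Qed.

Lemma gopD l : {morph gop l : w1 w2 / w1 + w2}.
Proof.
move=> w1 w2; apply/funext => xs; apply/funext => ys.
rewrite -[RHS]/(gop l w1 xs ys + gop l w2 xs ys) /gop.
rewrite -[eps l _ xs in RHS]mul1r -eps_lin; congr eps; apply/funext => a.
rewrite mul1r -[eps l (w1 a) ys]mul1r -eps_lin; congr eps; apply/funext => b.
by rewrite mul1r.
Qed.

Lemma gopN l w : gop l (- w) = - gop l w.
Proof.
have g0 : gop l 0 = 0 by apply: (addIr (gop l 0)); rewrite -gopD !add0r.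
by apply/eqP; rewrite -addr_eq0 -gopD addNr g0.
Qed.

Lemma copD v : {morph cop v : w1 w2 / w1 + w2}.
Proof. by []. Qed.

Lemma copN v w : cop v (- w) = - cop v w.
Proof. by []. Qed.

Lemma multialt0 : multialt 0.
Proof. by split=> u // s x y t a; rewrite mulr0 addr0. Qed.

Lemma multialtD w1 w2 : multialt w1 -> multialt w2 -> multialt (w1 + w2).
Proof.
move=> [a1 b1 c1 d1] [a2 b2 c2 d2].
have E xs ys : (w1 + w2) xs ys = w1 xs ys + w2 xs ys by [].
split=> u.
- by move=> s x y t a; rewrite !E a1 a2; ring.
- by move=> s x y t a; rewrite !E b1 b2; ring.
- by move=> s x t; rewrite !E c1 c2 addr0.
- by move=> s x t; rewrite !E d1 d2 addr0.
Qed.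

Lemma multialtN w : multialt w -> multialt (- w).
Proof.
move=> [a1 b1 c1 d1]; have E xs ys : (- w) xs ys = - w xs ys by [].
split=> u.
- by move=> s x y t a; rewrite !E a1; ring.
- by move=> s x y t a; rewrite !E b1; ring.
- by move=> s x t; rewrite !E c1 oppr0.
- by move=> s x t; rewrite !E d1 oppr0.
Qed.

Lemma multialt_cop v w : multialt w -> multialt (cop v w).
Proof.
move=> [a1 b1 c1 d1]; split=> u.
- exact: mlin_cons (a1 _).
- exact: mlin_cons (b1 _).
- exact: adjalt_cons (c1 _).
- exact: adjalt_cons (d1 _).
Qed.

Lemma multialt_gop l w : scalar l -> multialt w -> multialt (gop l w).
Proof.
move=> ll [a1 b1 c1 d1]; split=> u.
- rewrite (_ : gop l w u = eps l (fun b => eps l (w^~ b) u)); last first.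
    by apply/funext => b; rewrite gop_exch.
  apply: eps_mlin => // s x y t a; rewrite -eps_lin; congr eps.
  by apply/funext => b; rewrite a1.
- apply: eps_mlin => // s x y t a; rewrite -eps_lin; congr eps.
  by apply/funext => b; rewrite (b1 b).
- rewrite (_ : gop l w u = eps l (fun b => eps l (w^~ b) u)); last first.
    by apply/funext => b; rewrite gop_exch.
  by apply: eps_adjalt => s x t; rewrite eps_zero // => b _; rewrite c1.
- by apply: eps_adjalt => s x t; rewrite eps_zero // => b _; rewrite (d1 b).
Qed.

(** Exchanging the two middle products groups those of each slot, so that [eps_sq] and [eps_anti]
    apply slot by slot. *)
Lemma gop_gop l l' w xs ys : gop l (gop l' w) xs ys =
  eps l (eps l' (fun c => eps l (eps l' (w c)) ys)) xs.
Proof.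
congr eps; apply/funext => a.
exact: (eps_exch _ _ (fun b c => eps l' (w c) b)).
Qed.

Lemma gop_sq l w : gop l (gop l w) = 0.
Proof.
by apply/funext => xs; apply/funext => ys; rewrite gop_gop eps_sq.
Qed.

Lemma gopC l l' w : gop l (gop l' w) = gop l' (gop l w).
Proof.
apply/funext => xs; apply/funext => ys; rewrite !gop_gop eps_anti.
rewrite -mulN1r -epsZ; congr eps; apply/funext => a; rewrite -epsZ.
by congr eps; apply/funext => c; rewrite mulN1r eps_anti opprK.
Qed.

Lemma cop_sq v w : multialt w -> cop v (cop v w) = 0.
Proof.
case=> _ _ wa _; apply/funext => xs; apply/funext => ys.
exact: (wa _ [::]).
Qed.

Lemma copC u v w : multialt w -> cop u (cop v w) = cop v (cop u w).
Proof.
case=> wl1 wl2 wa1 wa2; apply/funext => xs; apply/funext => ys; rewrite /cop.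
rewrite (adjalt_swap u v ys (wl1 _) (wa1 _)).
by rewrite (adjalt_swap u v xs (wl2 _) (wa2 _)) opprK.
Qed.

(** Along the head argument [v] the term in [l v] drops and each slot leaves one sign; the two signs
    cancel. *)
Lemma cop_gop l v w : l v = 0 -> cop v (gop l w) = gop l (cop v w).
Proof.
move=> lv; apply/funext => xs; apply/funext => ys; rewrite /cop /gop /=.
rewrite lv mul0r sub0r -mulN1r -epsZ; congr eps; apply/funext => a.
by rewrite mul0r sub0r mulN1r opprK.
Qed.

Lemma dmulE w1 w2 xs ys : dmul w1 w2 xs ys =
  unshuffle (fun a b => unshuffle (fun c d => w1 a c * w2 b d) ys) xs.
Proof.
apply: eq_bigr => m _; rewrite /unshuffle mulr_sumr; apply: eq_bigr => q _.
ring.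
Qed.

(** Associativity of the product with [l] tensor [l] on the left, from [eps_unshuffle] in each
    slot. *)
Lemma dmul_gop l w1 w2 : dmul (gop l w1) w2 = gop l (dmul w1 w2).
Proof.
apply/funext => xs; apply/funext => ys; rewrite dmulE /gop.
rewrite (_ : (fun a => eps l (dmul w1 w2 a) ys) = unshuffle (fun a b =>
    eps l (unshuffle (fun c d => w1 a c * w2 b d)) ys)); last first.
  apply/funext => a; rewrite unshuffle_eps.
  by congr eps; apply/funext => c; rewrite dmulE.
rewrite -eps_unshuffle; congr unshuffle.
apply/funext => a; apply/funext => b.
rewrite (_ : (fun u => _) = fun u =>
    unshuffle (fun c d => eps l (fun c' => w1 u c' * w2 b d) c) ys); last first.
  by apply/funext => u; rewrite -eps_unshuffle.
rewrite -unshuffle_eps; congr unshuffle.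
apply/funext => c; apply/funext => d.
have E (f : seq V -> R) k s : eps l f s * k = eps l (fun u => f u * k) s.
  by rewrite mulrC -epsZ; congr eps; apply/funext => u; rewrite mulrC.
by rewrite E; congr eps; apply/funext => u; rewrite E.
Qed.

Lemma dmul_suml (I : Type) (r : seq I) (F : I -> dform V) w :
  dmul (\sum_(i <- r) F i) w = \sum_(i <- r) dmul (F i) w.
Proof.
apply/funext => xs; apply/funext => ys; rewrite !fct_sumE dmulE.
under [RHS]eq_bigr do rewrite dmulE.
rewrite -unshuffle_sum; congr unshuffle; apply/funext => a; apply/funext => b.
rewrite -unshuffle_sum; congr unshuffle; apply/funext => c; apply/funext => d.
by rewrite !fct_sumE mulr_suml.
Qed.

Lemma dmul_sumr (I : Type) (r : seq I) (c : I -> R) (F : I -> dform V)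
    w1 w2 xs ys :
  (forall a b, w2 a b = \sum_(i <- r) c i * F i a b) ->
  dmul w1 w2 xs ys = \sum_(i <- r) c i * dmul w1 (F i) xs ys.
Proof.
move=> w2E; rewrite dmulE.
under [RHS]eq_bigr do rewrite dmulE -unshuffleZ.
rewrite -unshuffle_sum; congr unshuffle; apply/funext => a; apply/funext => b.
under [RHS]eq_bigr do rewrite -unshuffleZ.
rewrite -unshuffle_sum; congr unshuffle; apply/funext => u; apply/funext => v.
by rewrite w2E mulr_sumr; apply: eq_bigr => i _; rewrite mulrCA.
Qed.

Lemma dmul1 w : dmul (dform1 (V := V)) w = w.
Proof.
apply/funext => xs; apply/funext => ys; rewrite dmulE.
rewrite -[RHS](unshuffle_nilf (w^~ ys) xs).
congr unshuffle; apply/funext => a; apply/funext => b.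
rewrite -[in RHS](unshuffle_nilf (w b) ys) -unshuffleZ.
congr unshuffle; apply/funext => c; apply/funext => d.
by rewrite /dform1 /nilf -mulnb natrM mulrA.
Qed.

Lemma multialt_dmul w1 w2 : multialt w1 -> multialt w2 -> multialt (dmul w1 w2).
Proof.
move=> [a1 b1 c1 d1] [a2 b2 c2 d2].
have E w3 w4 xs : dmul w3 w4 xs = unshuffle (fun c d =>
    unshuffle (fun a b => w3 a c * w4 b d) xs).
  apply/funext => ys; rewrite /dmul exchange_big; apply: eq_bigr => m _.
  by rewrite /unshuffle mulr_sumr; apply: eq_bigr => q _; ring.
have E' w3 w4 ys : (dmul w3 w4)^~ ys = unshuffle (fun a b =>
    unshuffle (fun c d => w3 a c * w4 b d) ys).
  by apply/funext => xs; rewrite dmulE.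
split=> u.
- rewrite E; apply: unshuffle_mlin => v s x y t a; rewrite -unshuffle_lin;
    congr unshuffle; apply/funext => c; apply/funext => d.
    by rewrite a2; ring.
  by rewrite a1; ring.
- rewrite E'; apply: unshuffle_mlin => v s x y t a; rewrite -unshuffle_lin;
    congr unshuffle; apply/funext => c; apply/funext => d.
    by rewrite (b2 d); ring.
  by rewrite (b1 c); ring.
- rewrite E; apply: unshuffle_adjalt => v s x t; rewrite -(unshuffle0 u);
    congr unshuffle; apply/funext => c; apply/funext => d.
    by rewrite c2 mulr0.
  by rewrite c1 mul0r.
- rewrite E'; apply: unshuffle_adjalt => v s x t; rewrite -(unshuffle0 u);
    congr unshuffle; apply/funext => c; apply/funext => d.
    by rewrite (d2 d) mulr0.
  by rewrite (d1 c) mul0r.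
Qed.

Lemma multialt_dform1 : multialt (@dform1 R V).
Proof.
split=> u; rewrite /dform1.
- by move=> [|? s] x y t a /=; rewrite andbF mulr0 addr0.
- by move=> [|? s] x y t a /=; rewrite mulr0 addr0.
- by move=> [|? s] x t /=; rewrite andbF.
- by move=> [|? s] x t /=.
Qed.

Lemma multialt_double_form p q w : double_form p q w -> multialt w.
Proof.
case=> wl wr; split=> u.
- by case: (wr u).
- by case: (wl u).
- by move=> s x t; have [_ + _] := wr u => /(_ s x [::] t).
- by move=> s x t; have [_ + _] := wl u => /(_ s x [::] t).
Qed.

(* [w] lives in bidegree [(p - j, p - j)], and vanishes if [p < j]. *)
Definition bideg (p j : nat) w := forall xs ys,
  (size xs + j != p)%N || (size ys + j != p)%N -> w xs ys = 0.

Lemma bideg_cop p j v w : bideg p j w -> bideg p j.+1 (cop v w).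
Proof.
by move=> wp xs ys; rewrite -!addSnnS; exact: (wp (v :: xs) (v :: ys)).
Qed.

Lemma bideg_gop p j l w : bideg p j w -> bideg p.+1 j (gop l w).
Proof.
move=> wp xs ys; have [sx _|sx /= sy] := boolP (size xs + j != p.+1)%N.
  apply: eps_zero => u su; apply: eps_zero => u' _; apply: wp.
  by rewrite -su addSn eqSS in sx; rewrite sx.
apply: eps_zero => u _; apply: eps_zero => u' su; apply: wp.
by rewrite -su addSn eqSS in sy; rewrite sy orbT.
Qed.

Lemma bideg_dmul p q w1 w2 :
  bideg p 0 w1 -> bideg q 0 w2 -> bideg (p + q)%N 0 (dmul w1 w2).
Proof.
move=> w1p w2q xs ys; rewrite !addn0 dmulE => sxy.
apply: unshuffle_zero => a b ab; apply: unshuffle_zero => c d cd.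
have [/(w1p _ _) ->|] := boolP ((size a + 0 != p) || (size c + 0 != p))%N.
  by rewrite mul0r.
have [/(w2q _ _) ->|] := boolP ((size b + 0 != q) || (size d + 0 != q))%N.
  by rewrite mulr0.
rewrite !negb_or !negbK !addn0 => /andP[/eqP eb /eqP ed] /andP[/eqP ea /eqP ec].
by move: sxy; rewrite -ab -cd eb ed ea ec eqxx.
Qed.

End DoubleFormOperators.

(** * The metric as a sum of squares of covectors in an orthonormal basis *)

Section Metric.
Variables (R : realType) (V : vectType R) (g : {dot V for idfun}) (e : seq V).
Hypothesis onb_e : orthonormal_basis g e.
Implicit Types (w : dform V) (xs ys s : seq V).

Let dot_scalar v : scalar (g v).
Proof. by move=> a x y; rewrite linearPr. Qed.

Lemma onb_expand x : x = \sum_(v <- e) g x v *: v.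
Proof.
case/andP: onb_e => oe be; apply: orthonormal_expand => //.
by rewrite (span_basis be) memvf.
Qed.

Lemma onb_dot u v : u \in e -> v \in e -> g u v = (u == v)%:R.
Proof.
case/andP: onb_e => + _; elim: e => // x s IH.
rewrite pair_orthoP !inE => /and3P[/eqP x1 /allP xo /IH os].
have sx y : y \in s -> (x == y) = false.
  move=> /xo /eqP xy; apply/eqP => E; move: xy; rewrite -E x1.
  by move/eqP; rewrite oner_eq0.
case/orP=> [/eqP ->|us] /orP[/eqP ->|vs]; last exact: os.
- by rewrite x1 eqxx.
- by rewrite (eqP (xo _ vs)) sx.
- by rewrite dotC (eqP (xo _ us)) eq_sym sx.
Qed.

Lemma onb_uniq : uniq e.
Proof.
by case/andP: onb_e => oe _; exact: free_uniq (Defs.orthonormal_free oe).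
Qed.

Lemma mlin_eq0 (f : seq V -> R) r : mlin f ->
  (forall s, {subset s <= e} -> size s = r -> f s = 0) ->
  forall s, size s = r -> f s = 0.
Proof.
(* The prefix, empty at first, holds the arguments already in the basis; the induction expands the
   next one. *)
move=> fl f0 t; rewrite -[t]cat0s; have: {subset [::] <= e} by [].
elim: t [::] => [|x t IH] s se str; first by rewrite f0 ?cats0 // -str cats0.
have fs (q : seq V) (a : V -> R) : {subset q <= e} ->
    f (s ++ \sum_(v <- q) a v *: v :: t) = 0.
  elim: q => [|v q IHq] qe.
    have := fl s 0 0 t 1; rewrite scaler0 addr0 mul1r big_nil; lra.
  rewrite big_cons fl IHq ?addr0; last first.
    by move=> u uq; rewrite qe // inE uq orbT.
  rewrite -cat_rcons IH ?mulr0 //; last by rewrite cat_rcons -str !size_cat.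
  move=> u; rewrite mem_rcons inE.
  by case/orP=> [/eqP ->|/se //]; rewrite qe ?mem_head.
by rewrite [x]onb_expand fs.
Qed.

(** Parseval's identity. It turns multiplication by the metric into the sum of the operators
    [gop (g v)]. *)
Lemma metric_formE : metric_form g = \sum_(v <- e) gop (g v) (@dform1 R V).
Proof.
have E v s : eps (g v) (@nilf R V) s = if s is [:: x] then g v x else 0.
  case: s => [|x [|y s]] //=; rewrite /nilf /=; first by ring.
  by rewrite eps_zero => [|u _]; ring.
apply/funext => xs; apply/funext => ys; rewrite !fct_sumE.
have G v : gop (g v) (@dform1 R V) xs ys =
    eps (g v) (@nilf R V) xs * eps (g v) (@nilf R V) ys.
  rewrite mulrC -epsZ; congr eps; apply/funext => a; rewrite mulrC -epsZ.
  by congr eps; apply/funext => b; rewrite /dform1 /nilf -mulnb natrM.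
under eq_bigr do rewrite G !E.
case: xs {G} => [|x [|x' xs]] /=; try by rewrite big1 // => v _; rewrite mul0r.
case: ys => [|y [|y' ys]] /=; try by rewrite big1 // => v _; rewrite mulr0.
rewrite /metric_form [in LHS](onb_expand x) linear_sumlz; apply: eq_bigr => v _.
by rewrite linearZl_LR /= dotC.
Qed.

Lemma dmul_dexp_metric k w : dmul (dexp (metric_form g) k) w =
  iter k (fun y => \sum_(v <- e) gop (g v) y) w.
Proof.
elim: k => [|k IH]; first exact: dmul1.
rewrite iterS -IH /dexp iterS -/(dexp _ k) {1}metric_formE dmul_suml dmul_suml.
by apply: eq_bigr => v _; rewrite !dmul_gop dmul1.
Qed.

Lemma iter_contr j w xs ys :
  iter j (fun y => \sum_(v <- e) - cop v y) w xs ys =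
  (-1) ^+ j * iter j (contr e) w xs ys.
Proof.
elim: j xs ys => [|j IH] xs ys; first by rewrite mul1r.
rewrite !iterS !fct_sumE exprS mulN1r /contr mulNr mulr_sumr -sumrN.
by apply: eq_bigr => v _; rewrite -IH.
Qed.

Lemma bideg_contr (p j k : nat) w :
  bideg p k w -> bideg p (k + j)%N (iter j (contr e) w).
Proof.
elim: j => [|j IH] wp; first by rewrite addn0.
move=> xs ys sxy; rewrite iterS /contr big1 // => v _.
rewrite addnS in sxy; exact: (bideg_cop v (IH wp) sxy).
Qed.

Lemma bideg_metric (p j k : nat) w :
  bideg p j w -> bideg (p + k)%N j (dmul (dexp (metric_form g) k) w).
Proof.
rewrite dmul_dexp_metric; elim: k => [|k IH] wp; first by rewrite addn0.
move=> xs ys sxy; rewrite iterS !fct_sumE big1 // => v _.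
by rewrite addnS in sxy; exact: (bideg_gop (g v) (IH wp) sxy).
Qed.

(** * Factorization of exp(g) exp(-c) and its values on basis vectors *)

Let tg v := gop (g v).
Let tc v w := - cop v w.
(** Chosen so that [w + factor v w] is (1 + g_v)(1 - c_v) applied to [w]. *)
Let factor v w := gop (g v) (w - cop v w) - cop v w.

(** The head operator 1 - c_v slides out past each 1 + g_u with [u] in the tail, by orthogonality of
    [u] and [v]. *)
Lemma prod_metric_contr s w : uniq s -> {subset s <= e} ->
  prod1t tg s (prod1t tc s w) = prod1t factor s w.
Proof.
have C v s' y : {in s', forall u, g u v = 0} ->
    prod1t tg s' (y - cop v y) = prod1t tg s' y - cop v (prod1t tg s' y).
  elim: s' => //= u s' IH uv; rewrite IH; last first.
    by move=> z zs; rewrite uv // inE zs orbT.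
  rewrite copD /tg gopD gopN cop_gop ?uv ?mem_head // opprD addrACA.
  by [].
elim: s => //= v s IH /andP[vs us] se.
rewrite C; last first.
  move=> u ins; rewrite onb_dot ?se ?inE ?ins ?eqxx ?orbT //.
  by case: eqP vs => // <-; rewrite ins.
rewrite IH //; last by move=> u ins; rewrite se // inE ins orbT.
by rewrite /factor /tg -addrA [- _ + _]addrC.
Qed.

Lemma prod_factor_multialt s w : multialt w -> multialt (prod1t factor s w).
Proof.
apply: prod1t_closed => [x y|v x wx]; first exact: multialtD.
have xc := multialtD wx (multialtN (multialt_cop v wx)).
apply: multialtD (multialt_gop (dot_scalar v) xc) _.
exact: multialtN (multialt_cop v wx).
Qed.

Definition overlap (s t : seq V) : nat := count (mem s) t.

Lemma overlap_consl v s t : v \notin s -> uniq t ->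
  overlap (v :: s) t = ((v \in t) + overlap s t)%N.
Proof.
move=> vs ut; rewrite -count_uniq_mem // /overlap.
elim: t {ut} => //= y t ->; rewrite inE.
by case: eqP vs => [->|_ _] /=; [move/negPf ->; lia|lia].
Qed.

Lemma overlap_consr v s t : overlap s (v :: t) = ((v \in s) + overlap s t)%N.
Proof. by []. Qed.

Lemma overlap_cat s t1 t2 :
  overlap s (t1 ++ t2) = (overlap s t1 + overlap s t2)%N.
Proof. exact: count_cat. Qed.

(** Each [v] of [s] absent from both lists may lengthen the first by one, and each [v] in both
    shortens it by one. So [size xs + size s] minus the overlaps is the largest size reached, and
    [w] vanishes below size [p]. *)
Lemma prod_factor_eval p s w xs ys : multialt w -> bideg p 0 w ->
  uniq s -> {subset s <= e} -> uniq xs -> {subset xs <= e} ->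
  uniq ys -> {subset ys <= e} ->
  (size xs + size s < p + (overlap s xs + overlap s ys))%N ->
  prod1t factor s w xs ys = 0.
Proof.
move=> wa wp; elim: s xs ys => [|v s IH] xs ys us se ux xe uy ye.
  rewrite /overlap /= !count_pred0 !addn0 => xp; apply: wp.
  by rewrite addn0 neq_ltn xp.
have /andP[vs us'] := us; have ve := se v (mem_head v s).
have {}se : {subset s <= e} by move=> u ins; rewrite se // inE ins orbT.
have {}IH xs' ys' := IH xs' ys' us' se.
rewrite !overlap_consl //= => lt_p.
have := prod_factor_multialt s wa; set psi := prod1t factor s w => psia.
rewrite -/psi in IH; have [pl1 pl2 pa1 pa2] := psia.
set chi := psi - cop v psi.
rewrite -[LHS]/(psi xs ys + (gop (g v) chi xs ys - psi (v :: xs) (v :: ys))).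
have gv0 (zs : seq V) : {subset zs <= e} -> v \notin zs ->
     {in zs, forall x, g v x = 0}.
  move=> ze vz x xz; rewrite (onb_dot ve (ze _ xz)).
  by case: eqP vz => // ->; rewrite xz.
have psi0 x0 y0 : v \in x0 -> psi (v :: x0) y0 = 0.
  by move=> vx; apply: (adjalt_nuniq (f := psi^~ y0)) => //=; rewrite vx.
have psi0' x0 y0 : v \in y0 -> psi x0 (v :: y0) = 0.
  by move=> vy; apply: (adjalt_nuniq (f := psi x0)) => //=; rewrite vy.
have [vx|vx] := boolP (v \in xs); have [vy|vy] := boolP (v \in ys); last first.
(* [v] in neither list: the product by [g v] vanishes by orthogonality, the other two terms by
   induction. *)
- rewrite IH //; last by rewrite (negPf vx) (negPf vy) in lt_p; lia.
  rewrite [gop _ _ _ _]eps_perp; last exact: gv0.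
  rewrite IH ?subrr ?addr0 //.
  + by rewrite /= vx.
  + by move=> u; rewrite inE => /orP[/eqP ->|/xe].
  + by rewrite /= vy.
  + by move=> u; rewrite inE => /orP[/eqP ->|/ye].
  + rewrite !overlap_consr (negPf vs) /=;
      by rewrite (negPf vx) (negPf vy) in lt_p; lia.
(* [v] in one list only, here and in the next case: the product vanishes through the list lacking
   [v], the contraction through the repetition in the other. *)
- rewrite IH //; last by rewrite (negPf vx) vy in lt_p; lia.
  rewrite [gop _ _ _ _]eps_perp; last exact: gv0.
  by rewrite psi0' // subrr addr0.
- rewrite IH //; last by rewrite vx (negPf vy) in lt_p; lia.
  rewrite gop_exch eps_perp; last exact: gv0.
  by rewrite psi0 // subrr addr0.
(* [v] in both lists: the contraction vanishes. With [v] moved to the front, the product gives [chi]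
   on the lists without [v], whose contracted part cancels [psi xs ys] up to the common sign. This
   leaves [psi] on the shorter lists. *)
rewrite psi0 // subr0.
rewrite vx vy in lt_p; case/splitPr: vx ux xe lt_p => x1 x2 ux xe lt_p.
case/splitPr: vy uy ye lt_p => y1 y2 uy ye lt_p.
have chia : multialt chi.
  by apply: multialtD => //; apply: multialtN; apply: multialt_cop.
have [gl1 gl2 ga1 ga2] := multialt_gop (dot_scalar v) chia.
rewrite (adjalt_front (f := psi^~ _)) // (adjalt_front (f := psi _)) //.
rewrite (adjalt_front (f := (gop _ _)^~ _)) //.
rewrite (adjalt_front (f := gop _ _ _)) // -mulrDr -mulrDr.
move: ux uy; rewrite (uniq_catCA x1 [:: v]) (uniq_catCA y1 [:: v]) /=.
move=> /andP[vx ux] /andP[vy uy].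
have xe' : {subset x1 ++ x2 <= e}.
  by move=> u ux'; apply: xe; rewrite mem_cat inE orbCA -mem_cat ux' orbT.
have ye' : {subset y1 ++ y2 <= e}.
  by move=> u uy'; apply: ye; rewrite mem_cat inE orbCA -mem_cat uy' orbT.
have gvv : g v v = 1 by rewrite onb_dot // eqxx.
have -> : gop (g v) chi (v :: x1 ++ x2) (v :: y1 ++ y2) =
    chi (x1 ++ x2) (y1 ++ y2).
  rewrite /gop /= gvv !mul1r eps_perp ?subr0; last exact: gv0.
  by rewrite eps_perp ?subr0 //; exact: gv0.
rewrite -[chi _ _]/(psi (x1 ++ x2) (y1 ++ y2) -
  psi (v :: x1 ++ x2) (v :: y1 ++ y2)) addrC subrK IH ?mulr0 //.
move: lt_p; rewrite !(overlap_cat, overlap_consr) (negPf vs) !size_cat /=; lia.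
Qed.

Lemma prod_factor_eq0 p r w xs ys : multialt w -> bideg p 0 w ->
  (size e < p + r)%N -> size xs = r -> size ys = r ->
  prod1t factor e w xs ys = 0.
Proof.
move=> wa wp er; have [fl1 fl2 fa1 fa2] := prod_factor_multialt e wa.
have oE s : {subset s <= e} -> overlap e s = size s.
  by move=> se; apply/eqP; rewrite -all_count; apply/allP.
move=> xr; move: ys; apply: mlin_eq0 => // ys ye yr.
move: xs xr; apply: (mlin_eq0 (f := (prod1t factor e w)^~ ys)) => // xs xe xr.
have [ux|ux] := boolP (uniq xs); last first.
  exact: adjalt_nuniq (fl2 ys) (fa2 ys) ux.
have [uy|uy] := boolP (uniq ys); last first.
  exact: adjalt_nuniq (fl1 xs) (fa1 xs) uy.
apply: (prod_factor_eval wa wp onb_uniq) => //.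
(* Both overlaps with [e] equal [r], so the bound to check is [r + size e < p + (r + r)]. *)
by rewrite !oE // xr yr; lia.
Qed.

(** The double sum is exp(g) exp(-c) applied to [w]; truncation at [N] loses nothing, since both
    families of divided powers stop at [size e]. *)
Lemma sum_dmul_contr_eq0 p r N w xs ys : multialt w -> bideg p 0 w ->
  (size e < p + r)%N -> size xs = r -> size ys = r -> (size e < N)%N ->
  \sum_(k < N) \sum_(j < N) (-1) ^+ j / (j`! * k`!)%N%:R *
    dmul (dexp (metric_form g) k) (iter j (contr e) w) xs ys = 0.
Proof.
move=> wa wp er xr yr eN; rewrite -[RHS](prod_factor_eq0 wa wp er xr yr).
rewrite -prod_metric_contr ?onb_uniq //.
have Mn (F : dform V) k a b : (F *+ k) a b = F a b *+ k.
  by elim: k => // k IH; rewrite !mulrS -IH.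
have f0 k : k`!%:R != 0 :> R by rewrite pnatr_eq0 -lt0n fact_gt0.
have tgD v : {morph tg v : x y / x + y} by exact: gopD.
have tcD v : {morph tc v : x y / x + y} by move=> x y; rewrite /tc copD opprD.
have tcP v y : multialt y -> multialt (tc v y).
  by move=> ya; exact: multialtN (multialt_cop v ya).
have tgP v y : multialt y -> multialt (tg v y) by exact: multialt_gop.
(* The elementary symmetric functions of the -c_v are the divided powers of -c; [tgE] does the same
   for the metric. *)
have tcE j a b : divpow tc e j w a b =
    (-1) ^+ j / j`!%:R * iter j (contr e) w a b.
  apply: (mulfI (f0 j)); rewrite mulr_natl -Mn
    -(iter_divpow (P := @multialt R V)) //.
  - by rewrite iter_contr; field.
  - exact: multialt0.
  - exact: multialtD.
  - by move=> v y ya; rewrite /tc copN opprK; exact: cop_sq.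
  - by move=> u v y ya; rewrite /tc !copN !opprK; exact: copC.
set X := prod1t tc e w.
have Xa : multialt X.
  by apply: (prod1t_closed (P := @multialt R V)) => //; exact: multialtD.
have tgE k a b : divpow tg e k X a b =
    (k`!%:R)^-1 * dmul (dexp (metric_form g) k) X a b.
  apply: (mulfI (f0 k)); rewrite mulr_natl -Mn
    -(iter_divpow (P := @multialt R V)) //.
  - by rewrite dmul_dexp_metric mulVKf.
  - exact: multialt0.
  - exact: multialtD.
  - by move=> v y _; exact: gop_sq.
  - by move=> u v y _; exact: gopC.
rewrite -(sum_prod1t tgD X eN) !fct_sumE; apply: eq_bigr => k _.
rewrite tgE (dmul_sumr (r := index_enum 'I_N) (c := fun j => (-1) ^+ j / j`!%:R)
    (F := fun j => iter j (contr e) w)); last first.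
  move=> a b; rewrite /X -(sum_prod1t tcD w eN) !fct_sumE.
  by apply: eq_bigr => j _; rewrite tcE.
rewrite mulr_sumr; apply: eq_bigr => j _; rewrite natrM.
by field; rewrite !f0.
Qed.

(** On arguments of size [r], bidegree keeps from the double sum of [sum_dmul_contr_eq0] the terms
    with [k = r + j - p], which make up [h_form]. *)
Lemma h_form_eq0 m r w xs ys : double_form 2 2 w ->
  (size e < 2 * m + r)%N -> h_form g e w r m xs ys = 0.
Proof.
move=> w22 er; rewrite /h_form; set W := dexp w m; set p := (2 * m)%N.
have Wa : multialt W.
  rewrite /W /dexp; elim: (m) => [|k IH]; first exact: multialt_dform1.
  by rewrite iterS; exact: multialt_dmul (multialt_double_form w22) IH.
have w2 : bideg 2 0 w.
  case: w22 => wl wr x y; rewrite !addn0 => /orP[sx|sy].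
    by have [_ _ ->] := wl y.
  by have [_ _ ->] := wr x.
have Wp : bideg p 0 W.
  rewrite /W /dexp /p; elim: (m) => [|k IH].
    by move=> [|x xs'] [|y ys'] //= _; rewrite /dform1 ?andbF.
  by rewrite iterS mulnS; exact: bideg_dmul.
have deg0 j k : (size xs + j != p + k)%N || (size ys + j != p + k)%N ->
    dmul (dexp (metric_form g) k) (iter j (contr e) W) xs ys = 0.
  exact: (bideg_metric (bideg_contr (j := j) Wp)).
have [/andP[/eqP xr /eqP yr]|sxy] := boolP ((size xs == r) && (size ys == r));
    last first.
  (* The lower end of the range makes [r + j - p] exact, so every term has bidegree (r, r). *)
  rewrite big_nat big1 // => j /andP[jp _]; rewrite deg0 ?mulr0 //.
  by move: sxy jp; rewrite negb_and; lia.
(* [N] exceeds [size e], as the expansion requires, and all indices [j <= p] and [k <= r] occurring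
   in [h_form]. *)
have [N eN rN] : exists2 N, (size e < N)%N & (p + r < N)%N.
  by exists (p + r + size e).+1; rewrite ltnS ?leq_addl ?leq_addr.
rewrite -[RHS](sum_dmul_contr_eq0 Wa Wp er xr yr eN) exchange_big /=.
rewrite (big_nat_widen _ _ N) /=; last by lia.
rewrite (big_nat_widenl _ 0) // big_mkord big_mkcond /=.
apply: eq_bigr => j _; case: ifP => [/andP[jp pj]|pj].
  have kN : (r + j - p < N)%N by lia.
  rewrite (bigD1 (Ordinal kN)) //= big1 ?addr0 // => k kE.
  rewrite deg0 ?mulr0 // xr; apply/orP; left; apply: contraNneq kE => E.
  by apply/eqP/val_inj => /=; lia.
(* Outside the range, either [j < p - r] and no [k] has the right degree, or [j > p] and [j]
   contractions annihilate [W]. *)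
rewrite big1 // => k _; have [jp|jp] := leqP j p.
  by rewrite deg0 ?mulr0 // xr; apply/orP; left; move: pj; lia.
rewrite dmulE unshuffle_zero ?mulr0 // => a b _; apply: unshuffle_zero => c d _.
rewrite (bideg_contr (j := j) Wp) ?mulr0 //; apply/orP; left; lia.
Qed.

End Metric.

Theorem theorem3p8 (R : realType) (n : nat) (V : vectType R)
    (g : {dot V for idfun}) (dimV : \dim {:V} = n)
    (e : seq V) (onb_e : orthonormal_basis g e)
    (Rm : dform V) (Rm22 : double_form 2 2 Rm) (Rm_sym : dsymmetric Rm)
    (Rm_bianchi : first_bianchi Rm) (i : nat) :
  (forall k, n = (2 * k)%N ->
   forall m, (1 <= m)%N -> (n - 2 * i)%N = (2 * m)%N ->
   forall r, (2 * i + 1 <= r <= n - 2 * i)%N ->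
   forall xs ys, h_form g e Rm r m xs ys = 0)
  /\
  (forall k, n = (2 * k + 1)%N ->
   forall m, (1 <= m)%N -> (n - 2 * i - 1)%N = (2 * m)%N ->
   forall r, (2 * i + 2 <= r <= n - 2 * i - 1)%N ->
   forall xs ys, h_form g e Rm r m xs ys = 0).
Proof.
have se : size e = n.
  by case/andP: onb_e => _ be; rewrite -dimV (size_basis (X := in_tuple e) be).
(* In both parities the lower bound on [r] gives [2 * m + r >= n + 1]. *)
by split=> k nE m m1 mE r /andP[r1 r2] xs ys; apply: h_form_eq0 => //; lia.
Qed.
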